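(* There is a sequence of valid modal implications $(\phi_n\to\psi_n)_{n=1,2,\dots}$ such that (1) $|\phi_n|$ and $|\psi_n|$ are bounded by a polynomial in $n$, and (2) every Craig interpolant $\vartheta$ for $\phi_n\to\psi_n$ (a modal formula with $\models\phi_n\to\vartheta$, $\models\vartheta\to\psi_n$ and $\mathrm{sig}(\vartheta)\subseteq\mathrm{sig}(\phi_n)\cap\mathrm{sig}(\psi_n)$) has DAG-size $|\vartheta|_{\mathrm{DAG}}\ge 2^n$.
   Context: Modal formulas are built from proposition letters, $\top,\bot,\neg,\land,\lor,\Diamond,\Box$; $\models$ is validity over all Kripke models (logic $\mathsf K$); $\mathrm{sig}(\chi)$ is the set of proposition letters in $\chi$. $|\chi|$ is the length of $\chi$ (number of symbols when written as a string), and $|\chi|_{\mathrm{DAG}}$ is the number of distinct subformulas of $\chi$. *)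

(* Defs.v *)
From HB Require Import structures.
From mathcomp Require Import all_boot all_algebra.

Set Implicit Arguments.
Unset Strict Implicit.
Unset Printing Implicit Defensive.

Inductive mform : Type :=
| Var of nat
| Top
| Bot
| Neg of mform
| And of mform & mform
| Or of mform & mform
| Dia of mform
| Box of mform.

Lemma mform_comparable : comparable mform.
Proof. by move=> a b; rewrite /decidable; decide equality; exact: eq_comparable. Qed.

HB.instance Definition _ := hasDecEq.Build mform (compareP mform_comparable).

(* The arrow is not a primitive connective. *)
Definition Imp (a b : mform) : mform := Or (Neg a) b.

Record kripke : Type := Kripke {
  world :> Type;
  acc : world -> world -> Prop;
  valuation : nat -> world -> Prop
}.

(* Read classically: the clauses live in Prop, with excluded middle available. *)
Fixpoint sat (M : kripke) (w : M) (f : mform) : Prop :=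
  match f with
  | Var p => valuation p w
  | Top => True
  | Bot => False
  | Neg a => ~ sat w a
  | And a b => sat w a /\ sat w b
  | Or a b => sat w a \/ sat w b
  | Dia a => exists v : M, acc w v /\ sat v a
  | Box a => forall v : M, acc w v -> sat v a
  end.

Definition valid (f : mform) : Prop := forall (M : kripke) (w : M), sat w f.

Fixpoint msig (f : mform) : seq nat :=
  match f with
  | Var p => [:: p]
  | Top | Bot => [::]
  | Neg a | Dia a | Box a => msig a
  | And a b | Or a b => msig a ++ msig b
  end.

Inductive symbol : Type :=
| SVar of nat
| STop | SBot | SNeg | SAnd | SOr | SDia | SBox
| SLpar | SRpar.

(* Each proposition letter is a single symbol; binary connectives are written
   infix and enclosed in parentheses. *)
Fixpoint string_of (f : mform) : seq symbol :=
  match f with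
  | Var p => [:: SVar p]
  | Top => [:: STop]
  | Bot => [:: SBot]
  | Neg a => SNeg :: string_of a
  | And a b => SLpar :: string_of a ++ SAnd :: string_of b ++ [:: SRpar]
  | Or a b => SLpar :: string_of a ++ SOr :: string_of b ++ [:: SRpar]
  | Dia a => SDia :: string_of a
  | Box a => SBox :: string_of a
  end.

Definition flength (f : mform) : nat := size (string_of f).

Fixpoint subforms (f : mform) : seq mform :=
  f :: match f with
       | Var _ | Top | Bot => [::]
       | Neg a | Dia a | Box a => subforms a
       | And a b | Or a b => subforms a ++ subforms b
       end.

Definition dag_size (f : mform) : nat := size (undup (subforms f)).

Definition craig_interpolant (phi psi theta : mform) : Prop :=
  [/\ valid (Imp phi theta),
      valid (Imp theta psi)
    & {subset msig theta <= [predI msig phi & msig psi]}].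

(* Main.v *)
Require Import Defs.
From mathcomp Require Import all_boot all_algebra.
From mathcomp Require Import zify.
From Stdlib Require Import Classical.

(** Write r_j = Var j, p_j = Var (n + j), q_j = Var (n + n + j) for j < n.
    The formula phi says that the worlds at depth n carry all 2^n values of r
    and that each of them has a successor on which p = r; the negation of psi
    says that q is constant and p <> q at depth n + 1.  Over the common letters
    p, the formula phi holds on a chain of length n followed by a fan with all
    2^n values of p, whereas psi fails on the same chain and fan with any single
    value a removed.  An interpolant tells these two apart for every a; as leaves
    are classified propositionally, this forces it to contain some Dia h with h
    true at a only, or some Box h with h false at a only.  These subformulas are
    distinct for distinct a. *)

Set Implicit Arguments.
Unset Strict Implicit.
Unset Printing Implicit Defensive.

(** * Construction of the two formulas *)

Fixpoint conj (n : nat) (F : nat -> mform) : mform :=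
  if n is m.+1 then And (conj m F) (F m) else Top.

Definition equ (u v : nat) : mform :=
  Or (And (Var u) (Var v)) (And (Neg (Var u)) (Neg (Var v))).

Definition keep (v : nat) : mform :=
  Or (And (Var v) (Box (Var v))) (And (Neg (Var v)) (Box (Neg (Var v)))).

Definition branch (v : nat) : mform := And (Dia (Var v)) (Dia (Neg (Var v))).

(** At depth [i] the letters r_0, ..., r_(i-1) are already fixed and r_i branches; [k] is the
    remaining height, with [i + k = n] intended. One recursive call per level keeps the length
    quadratic. *)
Fixpoint phi_from (n i k : nat) : mform :=
  if k is k'.+1 then
    And (branch i) (And (conj i keep) (Box (phi_from n i.+1 k')))
  else And (conj n keep) (Dia (conj n (fun j => equ j (n + j)))).

Definition phi (n : nat) : mform := phi_from n 0 n.

Fixpoint avoid (n k : nat) : mform :=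
  And (conj n (fun j => keep (n + n + j)))
    (Box (if k is k'.+1 then avoid n k'
          else Neg (conj n (fun j => equ (n + n + j) (n + j))))).

Definition psi (n : nat) : mform := Neg (avoid n n).

(** * Validity of the implication *)

Lemma sat_conj (M : kripke) (w : M) n F :
  sat w (conj n F) <-> forall j, j < n -> sat w (F j).
Proof.
elim: n => [|n IHn] /=; first by split.
split=> [[/IHn sF sFn] j | sF].
  by rewrite ltnS leq_eqVlt => /predU1P[-> | /sF].
by split; [apply/IHn => j ltjn; apply: sF; rewrite ltnW | apply: sF].
Qed.

Lemma sat_equ (M : kripke) (w : M) u v :
  sat w (equ u v) -> (sat w (Var u) <-> sat w (Var v)).
Proof. by move=> /=; tauto. Qed.

Lemma sat_keep (M : kripke) (w w' : M) v : acc w w' -> sat w (keep v) ->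
  (sat w (Var v) <-> sat w' (Var v)).
Proof. by move=> ww' /= [] [wv /(_ _ ww')]; tauto. Qed.

(** Going down, one can always choose a child whose r_i agrees with q_i. At depth n this gives r =
    q, and the successor with p = r then has p = q, which [avoid] forbids. *)
Lemma phi_avoid_unsat (M : kripke) n k i (w : M) : i + k = n ->
  sat w (phi_from n i k) -> sat w (avoid n k) ->
  (forall j, j < i -> (sat w (Var j) <-> sat w (Var (n + n + j)))) -> False.
Proof.
elim: k i w => [|k IHk] i w ikn.
  case=> /sat_conj keepr [w' [ww' /sat_conj rp]] [/sat_conj keepq].
  move=> /(_ _ ww') nqp rq; apply: nqp; apply/sat_conj => j ltjn.
  have ltji: j < i by rewrite -(addn0 i) ikn.
  have := sat_equ (rp j ltjn); have := sat_keep ww' (keepr j ltjn).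
  have := sat_keep ww' (keepq j ltjn); have := rq j ltji.
  (* [equ] is a disjunction, so proving it takes a decided truth value. *)
  by move=> /=; have := classic (valuation j w'); tauto.
case=> -[[w1 [ww1 w1i]] [w0 [ww0 w0i]]] [/sat_conj keepr boxphi].
case=> /sat_conj keepq boxavoid rq.
have ltin : i < n by lia.
(* By induction no child has r_i equal to q_i, yet [branch i] supplies both values of r_i while q_i
   is the same at every child. *)
have step w' : acc w w' -> ~ (sat w' (Var i) <-> sat w' (Var (n + n + i))).
  move=> ww' rqi.
  apply: (IHk i.+1 w'); [lia | exact: boxphi | exact: boxavoid |].
  move=> j; rewrite ltnS leq_eqVlt => /predU1P[-> // | ltji].
  have := sat_keep ww' (keepr j ltji); have := rq j ltji.
  have := sat_keep ww' (keepq j (ltn_trans ltji ltin)).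
  by tauto.
have := sat_keep ww1 (keepq i ltin); have := sat_keep ww0 (keepq i ltin).
by have := step w1 ww1; have := step w0 ww0; move: w1i w0i => /=; tauto.
Qed.

Lemma phi_psi_valid n : valid (Imp (phi n) (psi n)).
Proof.
move=> M w; have [sphi|] := classic (sat w (phi n)); last by left.
by right=> savoid; apply: (phi_avoid_unsat _ sphi savoid).
Qed.

(** * Quadratic length bounds *)

Lemma flength_bin a b :
  (flength (And a b) = flength a + flength b + 3) *
  (flength (Or a b) = flength a + flength b + 3).
Proof. by rewrite /flength /= !size_cat /= !size_cat /=; split; lia. Qed.

Lemma flength_un a :
  (flength (Neg a) = (flength a).+1) * (flength (Dia a) = (flength a).+1) *
  (flength (Box a) = (flength a).+1).
Proof. by []. Qed.

Lemma flength_conj c n F : (forall j, flength (F j) = c) ->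
  flength (conj n F) = n * (c + 3) + 1.
Proof. by move=> Fc; elim: n => //= n IHn; rewrite flength_bin IHn Fc; lia. Qed.

Lemma flength_phi_from n i k : i + k = n ->
  flength (phi_from n i k) <= k * (20 * n + 16) + (38 * n + 6).
Proof.
elim: k i => [|k IHk] i ikn /=.
  (* Here 17 and 15 are the lengths of [keep v] and [equ u v]. *)
  rewrite flength_bin flength_un (@flength_conj 17) //.
  by rewrite (@flength_conj 15) //; lia.
have := IHk i.+1; rewrite !(flength_bin, flength_un) (@flength_conj 17) //.
by rewrite /flength /=; nia.
Qed.

Lemma flength_avoid n k :
  flength (avoid n k) <= k * (20 * n + 5) + (38 * n + 7).
Proof.
elim: k => [|k IHk]; rewrite /= !(flength_bin, flength_un).
  by rewrite (@flength_conj 17) // (@flength_conj 15) //; lia.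
by rewrite (@flength_conj 17) //; nia.
Qed.

Lemma flength_poly : exists P : {poly nat}, forall n : nat, 0 < n ->
  flength (phi n) <= P.[n]%R /\ flength (psi n) <= P.[n]%R.
Proof.
(* At [k = n] the two bounds are 20n^2 + 54n + 6 and, counting the outer negation, 20n^2 + 43n + 8;
   the coefficients are termwise maxima. *)
exists (Poly [:: 8; 54; 20]) => n _.
have ->: ((Poly [:: 8; 54; 20]).[n] = (20 * n + 54) * n + 8 :> nat)%R.
  by rewrite horner_Poly.
rewrite /psi flength_un; split.
  by have := @flength_phi_from n 0 n (add0n n); rewrite -/(phi n); nia.
by have := flength_avoid n n; nia.
Qed.

(** * Letters of the two formulas *)

Lemma msig_conj (P : pred nat) n F : (forall j, j < n -> all P (msig (F j))) ->
  all P (msig (conj n F)).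
Proof.
elim: n => //= n IHn PF; rewrite all_cat IHn ?PF // => j ltjn.
by apply: PF; rewrite ltnW.
Qed.

(** Together with [msig_avoid], this confines the letters of an interpolant to the p_j. *)
Lemma msig_phi_from n i k : i + k = n ->
  all (fun v => v < n + n) (msig (phi_from n i k)).
Proof.
elim: k i => [|k IHk] i ikn /=.
  by rewrite all_cat !msig_conj // => j ltjn /=; lia.
by rewrite all_cat IHk ?msig_conj => [|j ltji|] /=; lia.
Qed.

Lemma msig_avoid n k : all (leq n) (msig (avoid n k)).
Proof.
elim: k => [|k IHk] /=; rewrite all_cat.
  by rewrite !msig_conj // => j _ /=; lia.
by rewrite IHk msig_conj // => j _ /=; lia.
Qed.

(** * Full and punctured fans as Kripke models *)

Section Models.

Variable n : nat.
Implicit Types (S : pred (n.-tuple bool)) (x a : n.-tuple bool) (s : seq bool).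

(* A world at depth i <= n is the list of the values of r_0 .. r_(i-1); below a
   world s at depth n, the leaves are the s ++ x with x in S the value of p. *)
Definition fan_acc S s t : Prop :=
  (size s < n /\ exists b, t = rcons s b) \/
  (size s = n /\ exists2 x, S x & t = s ++ x).

(** The letters r and p are read off the list, and q is [a] everywhere. The default [false] makes
    every p_j false at depth at most n. *)
Definition fan_val (a : n.-tuple bool) (v : nat) s : Prop :=
  if v < n + n then nth false s v else nth false a (v - (n + n)).

Definition fan S a : kripke := Kripke (fan_acc S) (fan_val a).

Lemma fan_size S s t : fan_acc S s t -> size s <= n.
Proof. by case=> [[/ltnW] | [->]]. Qed.

Lemma fan_val_low a v s : v < n + n -> fan_val a v s = nth false s v.
Proof. by rewrite /fan_val => ->. Qed.

Lemma fan_val_high a j s : fan_val a (n + n + j) s = nth false a j.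
Proof. by rewrite /fan_val ltnNge leq_addr addKn. Qed.

Lemma fan_acc_nth S s t j : fan_acc S s t -> j < size s ->
  nth false t j = nth false s j.
Proof.
by case=> [[_ [b ->]] | [_ [x _ ->]]] ltjs; rewrite ?nth_rcons ?nth_cat ltjs.
Qed.

Lemma fan_keep S a (s : fan S a) v (b : bool) : fan_val a v s = b ->
  (forall t, fan_acc S s t -> fan_val a v t = b) -> sat s (keep v).
Proof.
move=> /= -> tb; case: b tb => tb; [left | right]; split=> // t st.
  by rewrite (tb t st).
by rewrite (tb t st).
Qed.

Lemma fan_keep_r S a (s : fan S a) j : j < size s -> j < n -> sat s (keep j).
Proof.
move=> ltjs ltjn; have ltj2 : j < n + n by lia.
apply: (@fan_keep S a s j (nth false s j)); first exact: fan_val_low.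
by move=> t st; rewrite fan_val_low // (fan_acc_nth st).
Qed.

Lemma fan_equ S a (s : fan S a) u v (b : bool) :
  fan_val a u s = b -> fan_val a v s = b -> sat s (equ u v).
Proof. by move=> /= -> ->; case: b; [left | right]. Qed.

Lemma full_fan_phi_from a i k (s : fan predT a) :
  size s = i -> i + k = n -> sat s (phi_from n i k).
Proof.
elim: k i s => [|k IHk] i s szs ikn.
  have szn : size s = n by rewrite szs -ikn addn0.
  split; first by apply/sat_conj => j ltjn; apply: fan_keep_r; rewrite ?szn.
  (* The leaf with p = r: the values of r at [s] are [s] itself. *)
  exists (s ++ s); split.
    by right; split=> //; exists (Tuple (introT eqP szn)).
  apply/sat_conj => j ltjn; apply: (@fan_equ _ _ _ _ _ (nth false s j)).
    by rewrite fan_val_low ?nth_cat ?szn ?ltjn //; lia.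
  rewrite fan_val_low ?nth_cat ?szn; last by lia.
  by rewrite ltnNge leq_addr addKn.
have ltin : i < n by lia.
have child b : fan_acc predT s (rcons s b).
  by left; rewrite szs; split=> //; exists b.
have childi b : fan_val a i (rcons s b) = b.
  by rewrite fan_val_low ?nth_rcons ?szs ?ltnn ?eqxx //; lia.
split; [split | split].
- by exists (rcons s true); split; [exact: child | rewrite /= childi].
- by exists (rcons s false); split; [exact: child | rewrite /= childi].
- by apply/sat_conj => j ltji; apply: fan_keep_r; rewrite ?szs //; lia.
move=> t [[_ [b ->]] | [szn]]; last by lia.
by apply: IHk; [rewrite size_rcons szs | lia].
Qed.

(** Since q is constantly [a], a leaf with p = q would have to be [s ++ a], which has been
    removed. *)
Lemma punctured_fan_avoid a k (s : fan (predC1 a) a) :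
  size s + k = n -> sat s (avoid n k).
Proof.
have keepq (t : fan (predC1 a) a) : sat t (conj n (fun j => keep (n + n + j))).
  apply/sat_conj => j _; apply: (@fan_keep _ _ _ _ (nth false a j)).
    exact: fan_val_high.
  by move=> u _; apply: fan_val_high.
elim: k s => [|k IHk] s szk; split=> //= t [[lt_sn [b ->]] | [szn [x xa ->]]].
- by lia.
- move=> /sat_conj qp; case/eqP: xa; apply/val_inj.
  apply: (@eq_from_nth _ false); rewrite !size_tuple // => j ltjn.
  have := sat_equ (qp j ltjn).
  rewrite /= fan_val_high fan_val_low ?nth_cat ?szn; last by lia.
  rewrite ltnNge leq_addr addKn /=.
  by case: (nth _ x j) (nth _ a j) => [] [] // [] // => [_ /(_ isT) | /(_ isT)].
- by apply: IHk; rewrite size_rcons; lia.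
- by lia.
Qed.

(** * Evaluation of formulas in the common letters *)

Fixpoint leaf_eval (x : n.-tuple bool) (f : mform) : bool :=
  match f with
  | Var v => nth false x (v - n)
  | Top | Box _ => true
  | Bot | Dia _ => false
  | Neg g => ~~ leaf_eval x g
  | And g h => leaf_eval x g && leaf_eval x h
  | Or g h => leaf_eval x g || leaf_eval x h
  end.

(* The value at the worlds at depth n - k. *)
Fixpoint chain_eval S (k : nat) (f : mform) : bool :=
  match f with
  | Var _ | Bot => false
  | Top => true
  | Neg g => ~~ chain_eval S k g
  | And g h => chain_eval S k g && chain_eval S k h
  | Or g h => chain_eval S k g || chain_eval S k h
  | Dia g => if k is k'.+1 then chain_eval S k' g
             else [exists x, S x && leaf_eval x g]
  | Box g => if k is k'.+1 then chain_eval S k' g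
             else [forall x, S x ==> leaf_eval x g]
  end.

Definition p_letter : pred nat := fun v => n <= v < n + n.

Lemma leaf_evalP S a f (s x : seq bool) (y : n.-tuple bool) :
  0 < n -> all p_letter (msig f) -> size s = n -> x = s ++ y ->
  reflect (@sat (fan S a) x f) (leaf_eval y f).
Proof.
move=> n_gt0 + szs ->.
(* A leaf has length n + n > n, too long for a world with successors. *)
have noacc t : ~ fan_acc S (s ++ y) t.
  by move=> /fan_size; rewrite size_cat szs size_tuple; lia.
elim: f => /= [v||| g IHg | g IHg h IHh | g IHg h IHh | g _ | g _].
- rewrite andbT => /andP[le_nv ltv]; rewrite fan_val_low // nth_cat szs.
  by rewrite ltnNge le_nv /=; exact: idP.
- by move=> _; left.
- by move=> _; right.
- by move=> /IHg P; apply: (iffP negP) => nP /P.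
- rewrite all_cat => /andP[/IHg Pg /IHh Ph].
  by apply: (iffP andP) => -[/Pg ? /Ph ?].
- rewrite all_cat => /andP[/IHg Pg /IHh Ph].
  by apply: (iffP orP) => -[/Pg | /Ph]; by [left | right].
- by move=> _; right=> -[t [/noacc]].
- by move=> _; left=> t /noacc.
Qed.

(** Up to the letters r, all worlds at one depth are bisimilar: every p_j is false there and the
    same values of p occur at the leaves below. Hence [Dia] and [Box] agree at depth less than n. *)
Lemma chain_evalP S a f k (s : seq bool) :
  0 < n -> all p_letter (msig f) -> size s + k = n ->
  reflect (@sat (fan S a) s f) (chain_eval S k f).
Proof.
move=> n_gt0.
elim: f k s => /= [v||| g IHg | g IHg h IHh | g IHg h IHh | g IHg | g IHg] k s.
- rewrite andbT => /andP[le_nv ltv] szk; rewrite fan_val_low // nth_default.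
    by right.
  by lia.
- by left.
- by right.
- by move=> sg /(IHg _ _ sg) P; apply: (iffP negP) => nP /P.
- rewrite all_cat => /andP[sg sh] szk.
  have [Pg Ph] := (IHg _ _ sg szk, IHh _ _ sh szk).
  by apply: (iffP andP) => -[/Pg ? /Ph ?].
- rewrite all_cat => /andP[sg sh] szk.
  have [Pg Ph] := (IHg _ _ sg szk, IHh _ _ sh szk).
  by apply: (iffP orP) => -[/Pg | /Ph]; by [left | right].
- case: k => [|k] sg szk.
    have szn : size s = n by lia.
    apply: (iffP existsP) => [[x /andP[Sx xg]] | [t [[[]|[_ [x Sx ->]]] tg]]].
    + exists (s ++ x); split; first by right; split=> //; exists x.
      exact: (leaf_evalP S a n_gt0 sg szn erefl).
    + by lia.
    + by exists x; rewrite Sx; apply/(leaf_evalP S a n_gt0 sg szn erefl).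
  have szk' b : size (rcons s b) + k = n by rewrite size_rcons; lia.
  apply: (iffP idP) => [gk | [t [[[_ [b ->]]|[szn]]]]].
  (* All children give the same value, so [true] is an arbitrary choice. *)
  + exists (rcons s true); split; last exact/(IHg k).
    by left; split; [lia | exists true].
  + by move/(IHg k); apply.
  + by lia.
- case: k => [|k] sg szk.
    have szn : size s = n by lia.
    apply: (iffP forallP) => [gx t [[lt_sn]|[_ [x Sx ->]]] | gt x].
    + by lia.
    + exact/(leaf_evalP S a n_gt0 sg szn erefl)/(implyP (gx x)).
    + apply/implyP => Sx; apply/(leaf_evalP S a n_gt0 sg szn erefl)/gt.
      by right; split=> //; exists x.
  have szk' b : size (rcons s b) + k = n by rewrite size_rcons; lia.
  apply: (iffP idP) => [gk t [[_ [b ->]]|[szn]] | gt].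
  + exact/(IHg k).
  + by lia.
  + apply/(IHg k (rcons s true)) => //; apply: gt.
    by left; split; [lia | exists true].
Qed.

(** * Isolating subformulas and the lower bound *)

Definition isolates (a : n.-tuple bool) (f : mform) : bool :=
  match f with
  | Dia g => [forall x, leaf_eval x g == (x == a)]
  | Box g => [forall x, leaf_eval x g == (x != a)]
  | _ => false
  end.

Lemma isolates_inj a b f : isolates a f -> isolates b f -> a = b.
Proof.
by case: f => //= g /forallP/(_ a)/eqP + /forallP/(_ a)/eqP => ->;
  rewrite eqxx; case: eqP.
Qed.

(** A difference between the two fans passes down to an argument until a modality at depth n. There,
    removing [a] matters to [Dia g] only if [a] is the sole witness, and to [Box g] only if [a] is
    the sole counterexample. *)
Lemma punctured_chain_eval a f k :
  chain_eval predT k f != chain_eval (predC1 a) k f ->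
  has (isolates a) (subforms f).
Proof.
elim: f k => //= [g IHg | g IHg h IHh | g IHg h IHh | g IHg | g IHg] k.
- by rewrite (inj_eq negb_inj); exact: IHg.
- rewrite has_cat; apply: contraR; rewrite negb_or => /andP[ng nh].
  by rewrite (eqP (contraR (@IHg k) ng)) (eqP (contraR (@IHh k) nh)).
- rewrite has_cat; apply: contraR; rewrite negb_or => /andP[ng nh].
  by rewrite (eqP (contraR (@IHg k) ng)) (eqP (contraR (@IHh k) nh)).
- case: k => [|k /IHg ->]; last by rewrite orbT.
  move=> neq; apply/orP; left; apply/forallP => x; apply/eqP.
  have [/existsP[y /andP[ya yg]]|/existsPn only_a] :=
    boolP [exists y, predC1 a y && leaf_eval y g].
    case/eqP: neq; transitivity true; first by apply/existsP; exists y.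
    by apply/esym/existsP; exists y; apply/andP.
  have false_off y : y != a -> leaf_eval y g = false.
    by move=> ya; have := only_a y; rewrite /= ya; case: leaf_eval.
  have [->|/false_off //] := eqVneq x a.
  (* If [g] failed at [a], removing [a] would not change the disjunction. *)
  apply: contraNT neq => nag; apply/eqP/eq_existsb => y /=.
  by have [->|//] := eqVneq y a; rewrite (negbTE nag).
- case: k => [|k /IHg ->]; last by rewrite orbT.
  move=> neq; apply/orP; left; apply/forallP => x; apply/eqP.
  have [/forallP true_off|/forallPn[y yg]] :=
    boolP [forall y, predC1 a y ==> leaf_eval y g]; last first.
    case/eqP: neq; transitivity false; [|apply/esym];
      apply/negbTE/forallPn; exists y => //.
    by move: yg; rewrite negb_imply => /andP[].
  have [->|xa] := eqVneq x a; last exact: (implyP (true_off x)).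
  apply: contraNF neq => ag; apply/eqP/eq_forallb => y /=.
  by have [->|//] := eqVneq y a; rewrite ag.
Qed.

(** Sending each of the 2^n tuples to the first subformula isolating it is injective. *)
Lemma isolates_dag_size f : (forall a, has (isolates a) (subforms f)) ->
  2 ^ n <= dag_size f.
Proof.
move=> isol; pose g a := nth Top (subforms f) (find (isolates a) (subforms f)).
have gP a : isolates a (g a) by exact: nth_find.
have g_inj : injective g.
  by move=> a b gab; apply: (@isolates_inj a b (g a)); rewrite // gab.
rewrite -card_bool -card_tuple cardE -(size_map g) uniq_leq_size //.
  by rewrite map_inj_uniq ?enum_uniq.
by move=> _ /mapP[a _ ->]; rewrite mem_undup mem_nth // -has_find.
Qed.

(** At the root [[::]], [theta] holds in the full fan because [phi n] does, and fails in each
    punctured fan because [psi n] does. *)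
Lemma interpolant_dag_size theta : 0 < n ->
  craig_interpolant (phi n) (psi n) theta -> 2 ^ n <= dag_size theta.
Proof.
move=> n_gt0 [phi_theta theta_psi sig_theta].
have sig_p : all p_letter (msig theta).
  apply/allP => v /sig_theta/andP[vphi vpsi]; apply/andP; split.
    exact: (allP (msig_avoid n n)).
  exact: (allP (msig_phi_from (add0n n))).
apply: isolates_dag_size => a; apply: (@punctured_chain_eval a theta n).
have ->: chain_eval predT n theta = true.
  apply/(@chain_evalP predT a theta n [::]) => //.
  have [|//] := phi_theta (fan predT a) [::].
  by case; apply: full_fan_phi_from.
rewrite eq_sym; apply/eqP => /(@chain_evalP _ a theta n [::]) stheta.
have [|] := theta_psi (fan (predC1 a) a) [::].
  by apply; apply: stheta.
by apply; apply: punctured_fan_avoid.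
Qed.

End Models.

Theorem theorem52 :
  exists phi psi : nat -> mform,
    (forall n : nat, 0 < n -> valid (Imp (phi n) (psi n))) /\
    (exists P : {poly nat}, forall n : nat, 0 < n ->
       flength (phi n) <= P.[n]%R /\ flength (psi n) <= P.[n]%R) /\
    (forall n : nat, 0 < n -> forall theta : mform,
       craig_interpolant (phi n) (psi n) theta -> 2 ^ n <= dag_size theta).
Proof.
exists phi, psi; split=> [n _|]; first exact: phi_psi_valid.
by split=> [|n n_gt0 theta]; [exact: flength_poly | exact: interpolant_dag_size].
Qed.
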